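(* Let $(W,W')$ be an exchangeable pair of real-valued random variables such that $$\mathbb{E}(W'\mid W)=(1-\lambda)W+R$$ for some random variable $R=R(W)$ and with $0<\lambda<1$. Assume that $\mathbb{E}(W^2)\le1$. Let $Z$ be a random variable with standard normal distribution. Then for any $A>0$, \begin{align*} d_{\mathrm K}(W,Z)\le{}&\sqrt{\mathbb{E}\Big(1-\frac1{2\lambda}\mathbb{E}[(W'-W)^2\mid W]\Big)^2}+\Big(\frac{\sqrt{2\pi}}4+1.5A\Big)\frac{\sqrt{\mathbb{E}(R^2)}}\lambda\\ &+\frac{0.41A^3}\lambda+1.5A+\frac1{2\lambda}\mathbb{E}\big((W-W')^21_{\{|W-W'|\ge A\}}\big). \end{align*} If $|W-W'|\le A$ for a constant $A$, then $$d_{\mathrm K}(W,Z)\le\sqrt{\mathbb{E}\Big(1-\frac1{2\lambda}\mathbb{E}[(W'-W)^2\mid W]\Big)^2}+\Big(\frac{\sqrt{2\pi}}4+1.5A\Big)\frac{\sqrt{\mathbb{E}(R^2)}}\lambda+\frac{0.41A^3}\lambda+1.5A.$$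
   Context: $(W,W')$ is an exchangeable pair if $(W,W')$ and $(W',W)$ have the same joint law. $R=R(W)$ means that $R$ is a measurable function of $W$. The Kolmogorov distance is $d_{\mathrm K}(X,Y)=\sup_{z\in\mathbb{R}}|P(X\le z)-P(Y\le z)|$. *)

(* Defs.v *)
From HB Require Import structures.
From mathcomp Require Import all_boot all_order all_algebra.
From mathcomp Require Import all_classical all_reals all_analysis.
From mathcomp Require Import measurable_realfun.

Set Implicit Arguments.
Unset Strict Implicit.
Unset Printing Implicit Defensive.

Import Order.TTheory GRing.Theory Num.Theory.
Import numFieldNormedType.Exports.

Local Open Scope classical_set_scope.
Local Open Scope ring_scope.

Section definitions.
Context {d : measure_display} {T : measurableType d} {R : realType}.
Variable P : probability T R.

Definition exchangeable (X Y : T -> R) : Prop :=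
  forall B : set (R * R), measurable B ->
    pushforward P (fun w => (X w, Y w)) B = pushforward P (fun w => (Y w, X w)) B.

(* [V] is a version of E(X | Y). The sets of sigma(Y) are the preimages under
   [Y] of the Borel sets. *)
Definition is_condexp (X : T -> R) (Y : {RV P >-> R}) (V : T -> R) : Prop :=
  [/\ measurable_fun [set: g_sigma_algebra_preimageType Y]
        (V : g_sigma_algebra_preimageType Y -> R),
      P.-integrable [set: T] (EFin \o V) &
      forall A : set T, g_sigma_algebra_preimage Y A ->
        (\int[P]_(w in A) (V w)%:E = \int[P]_(w in A) (X w)%:E)%E].

(* A version of E(X | Y), chosen classically. It exists whenever [X] is
   integrable ([condexpP]) and is a meaningless value otherwise. *)
Definition condexp (X : T -> R) (Y : {RV P >-> R}) : T -> R :=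
  xget (cst 0) [set V | is_condexp X Y V].

Lemma is_condexp_exists (X : T -> R) (Y : {RV P >-> R}) :
  P.-integrable [set: T] (EFin \o X) -> exists V, is_condexp X Y V.
Proof.
move=> intX.
have mY : measurable_fun [set: T] Y by exact: measurable_funPT.
have dom : induced_charge intX `<< P.
  apply/null_content_dominatesP => A mA PA0; rewrite /induced_charge.
  apply: null_set_integral => //.
  exact: measurable_int (integrableS measurableT mA (@subsetT _ A) intX).
pose nu : {charge set R -> \bar R} :=
  measure_function_pushforward__canonical__charge_Charge (induced_charge intX) mY.
pose mu : probability R R := distribution P Y.
have dom' : nu `<< mu by exact: dominates_pushforward.
pose g : R -> \bar R := Radon_Nikodym nu mu.
have gfin y : g y \is a fin_num by exact: Radon_Nikodym_fin_num.
have intg : mu.-integrable [set: R] g by exact: Radon_Nikodym_integrable.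
have mg : measurable_fun [set: R] g by exact: measurable_int intg.
pose V : T -> R := fine \o g \o Y.
have VE : EFin \o V = g \o Y by apply/funext => w; rewrite /V /= fineK.
have intV : P.-integrable [set: T] (EFin \o V).
  rewrite VE; apply/integrableP; split; first exact: measurableT_comp.
  move/integrableP : intg => [_].
  by rewrite /mu ge0_integral_distribution//; exact: measurableT_comp.
exists V; split => //.
  move=> _ B mB; rewrite setTI; exists ((fine \o g) @^-1` B).
    rewrite -[X in measurable X]setTI.
    have mfg : measurable_fun [set: R] (fine \o g) by exact: measurableT_comp.
    exact: mfg.
  by rewrite setTI.
move=> _ [B mB <-]; rewrite setTI.
have mYB : measurable (Y @^-1` B).
  by rewrite -[X in measurable X]setTI; exact: measurable_funPT.
have -> : (\int[P]_(w in Y @^-1` B) (V w)%:E =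
           \int[P]_(w in Y @^-1` B) (g \o Y) w)%E by rewrite -VE.
rewrite -integral_pushforward//; last by rewrite -VE; exact: integrableS intV.
by rewrite -[LHS](Radon_Nikodym_integral dom' mB).
Qed.

Lemma condexpP (X : T -> R) (Y : {RV P >-> R}) :
  P.-integrable [set: T] (EFin \o X) -> is_condexp X Y (condexp X Y).
Proof.
move=> intX; have [V XYV] := is_condexp_exists Y intX.
exact: (xgetPex (cst 0) (ex_intro _ V XYV)).
Qed.

End definitions.

Notation "''E_' P [ X | Y ]" := (@condexp _ _ _ P X%R Y)
  (at level 5, P, X, Y at level 4, format "''E_' P [ X  |  Y ]") : ring_scope.

(* The two variables may live on different probability spaces. *)
Definition kolmogorov_distance {d d' : measure_display}
    {T : measurableType d} {T' : measurableType d'} {R : realType}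
    {P : probability T R} {Q : probability T' R}
    (X : {RV P >-> R}) (Y : {RV Q >-> R}) : \bar R :=
  ereal_sup [set `|cdf X z - cdf Y z|%E | z in [set: R]].

(* Main.v *)
Require Import Defs.
From HB Require Import structures.
From mathcomp Require Import all_boot all_order all_algebra.
From mathcomp Require Import all_classical all_reals all_analysis.
From mathcomp Require Import measurable_realfun.
From mathcomp Require Import ring lra.

(** The proof is Stein's method for exchangeable pairs.  Fix [z] and let [f] be
    the bounded solution of the Stein equation
      [f' w - w * f w = 1(w <= z) - Phi z],
    so that [P(W <= z) - Phi z = E (f' W - W * f W)].

    The second term is rewritten with the pair.  The function
    [(y - x) * (f x + f y)] is antisymmetric, hence has mean [0] at [(W, W')];
    together with the regression equation this gives
    ([stein_exchangeable], for every bounded measurable [f])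
      [E ((W' - W) * (f W' - f W)) = 2 * (lambda * E (W f W) - E (r(W) f W))].
    Hence, with [D = W' - W],
      [P(W <= z) - Phi z = E (f' W * (1 - D^2 / (2 lambda)))
         + E (D^2 f' W - D (f W' - f W)) / (2 lambda) - E (r(W) f W) / lambda].
    Since [|f'| <= 1], conditioning on [W] bounds the first term by the mean of
    [|1 - E(D^2 | W) / (2 lambda)|], at most the square root in the theorem.
    Since [0 <= f <= sqrt (2 pi) / 4], the last term is controlled by [E |r(W)|].

    The middle term is the mean of [D * \int_0^D (f' W - f' (W + t)) dt]
    ([stein_rem]).  On [{|D| > A}] it is at most [D^2], because the values of [f']
    lie in an interval of length one.  On [{|D| <= A}], the Stein equation splits
    [f'] into [w * f w], whose increments are at most
    [(|w| + sqrt (2 pi) / 4) * |t|], and the indicator of [w <= z], which changes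
    only when [W] is within [A] of [z] ([stein_rem_split]).  The first part yields
    the term in [A^3], its constant being [(1 + sqrt (2 pi) / 4) / 4 <= 0.41]; the
    second is [E (D^2; |D| <= A, W in an interval of length A)], which
    [concentration] bounds by applying [stein_exchangeable] once more, to a
    truncated linear function bounded by [3 A / 2].

    The properties of [f] come from the ratio [mills = Phi / phi], to which [f] is
    proportional on the left of [z] and, after reflection, on its right: [mills]
    and [x * mills x] are nondecreasing, [x * mills x >= -1], and
    [mills x * Phi (- x) <= sqrt (2 pi) / 4]. *)

Set Implicit Arguments.
Unset Strict Implicit.
Unset Printing Implicit Defensive.

Import Order.TTheory GRing.Theory Num.Theory.
Import numFieldNormedType.Exports.

Local Open Scope classical_set_scope.
Local Open Scope ring_scope.

(** * Monotonicity from derivatives *)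

Lemma is_derive_continuous {R : realType} (k dk : R -> R) :
  (forall x : R, is_derive x 1 k (dk x)) -> continuous k.
Proof.
move=> kd x; apply/differentiable_continuous/derivable1_diffP.
by have [] := kd x.
Qed.

(** The derivative is allowed to be missing at one point because the Stein
    solution has a kink at [z]. *)
Lemma nondecreasing_except {R : realType} (z : R) (k dk : R -> R) (a b : R) :
    a <= b -> continuous k ->
    (forall x : R, a < x < b -> x != z -> is_derive x 1 k (dk x) /\ 0 <= dk x) ->
  k a <= k b.
Proof.
move=> ab kc kd.
have mono (u v : R) : a <= u -> u <= v -> v <= b -> (v <= z) || (z <= u) ->
    k u <= k v.
  move=> au uv vb zuv.
  have kduv x : x \in `]u, v[ -> is_derive x 1 k (dk x) /\ 0 <= dk x.
    rewrite in_itv/= => /andP[ux xv]; apply: kd; first by lra.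
    by apply/eqP => xz; move: zuv => /orP[]; lra.
  rewrite -subr_ge0; move: uv; rewrite le_eqVlt => /predU1P[->|uv].
    by rewrite subrr.
  have [|c /kduv[_ dk0] ->] := @MVT R k dk _ _ uv (fun x h => (kduv x h).1).
    exact: continuous_subspaceT.
  by rewrite mulr_ge0// subr_ge0 ltW.
have [zb|zb] := leP b z; first by rewrite mono ?zb//.
have [za|za] := leP z a; first by rewrite mono ?za ?orbT//.
by apply: (@le_trans _ _ (k z)); apply: mono => //; rewrite ?lexx ?orbT// ltW.
Qed.

Lemma nondecreasing_derive {R : realType} (k dk : R -> R) (a b : R) :
    (forall x : R, is_derive x 1 k (dk x)) ->
    (forall x : R, a < x < b -> 0 <= dk x) -> a <= b -> k a <= k b.
Proof.
move=> kd dk0 ab; apply: (@nondecreasing_except _ b k dk) => //.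
  exact: is_derive_continuous kd.
by move=> x xab _; split; [exact: kd|exact: dk0].
Qed.

(** A nondecreasing function that is [O(1/|y|)] from below at [-oo] is
    nonnegative: a negative value [k x] would force [y * k y >= y * k x], which
    tends to [+oo] as [y] tends to [-oo]. *)
Lemma ge0_of_decay {R : realType} (k dk : R -> R) (C : R) :
    (forall x : R, is_derive x 1 k (dk x)) -> (forall x, 0 <= dk x) ->
    (forall y, y < 0 -> y * k y <= C) ->
  forall x, 0 <= k x.
Proof.
move=> kd dk0 kC x; rewrite leNgt; apply/negP => kx0.
(* far enough to the left for [y * k x] to exceed [|C|] *)
pose y := Num.min x (Num.min (-1) ((`|C| + 1) / k x)).
have yx : y <= x by rewrite ge_min lexx.
have y1 : y <= -1 by rewrite !ge_min lexx orbT.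
have yC : y <= (`|C| + 1) / k x by rewrite !ge_min lexx !orbT.
have kyx : k y <= k x by apply: (@nondecreasing_derive _ k dk).
have := kC y ltac:(lra).
rewrite ler_ndivlMr// in yC.
have := ler_norm C.
have : y * k x <= y * k y by nra.
lra.
Qed.

(** * The standard normal distribution and its Mills ratio *)

Section std_normal.
Context {R : realType}.
Implicit Types x y z w : R.

Definition phi x : R := normal_pdf 0 1 x.
Definition Phi x : R := fine (normal_prob 0 1 `]-oo, x]%classic).

Lemma phiE x : phi x = (Num.sqrt (2 * pi))^-1 * expR (- (x ^+ 2 / 2)).
Proof.
rewrite /phi normal_pdfE ?oner_eq0// /normal_peak /normal_fun subr0.
by rewrite expr1n mul1r -[pi *+ 2]mulr_natl -mulr_natl mulr1 mulNr.
Qed.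

Lemma phi_gt0 x : 0 < phi x.
Proof. by rewrite phiE mulr_gt0 ?expR_gt0// invr_gt0 sqrtr_gt0 mulr_gt0 ?pi_gt0. Qed.

Lemma phiN x : phi (- x) = phi x.
Proof. by rewrite !phiE sqrrN. Qed.

Lemma is_derive_phi x : is_derive x 1 phi (- x * phi x).
Proof.
rewrite (_ : phi = fun x => (Num.sqrt (2 * pi))^-1 * expR (- (x ^+ 2 / 2))); last first.
  by apply/funext => y; exact: phiE.
apply: is_derive_eq.
rewrite /GRing.scale/=.
by field; rewrite gt_eqF// sqrtr_gt0 mulr_gt0 ?pi_gt0.
Qed.

Lemma is_derive_Phi x : is_derive x 1 Phi (phi x).
Proof.
have xu : x < x + 1 by rewrite ltrDl.
have cphi : {for x, continuous phi}.
  by apply: continuous_normal_pdf; rewrite oner_eq0.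
have [||d d'] := @continuous_FTC1 R phi -oo%O x _ xu _ _ cphi.
- apply: (@integrableS _ _ _ _ setT) => //.
  exact: integrable_normal_pdf.
- by rewrite ltNyr.
- by rewrite -d' derive1E; exact/derivableP.
Qed.

Let idR : measurableTypeR R -> R := idfun.

#[local] HB.instance Definition _ :=
  @isMeasurableFun.Build _ _ _ _ idR (@measurable_id _ _ setT).

Lemma cdf_normal : cdf (idR : {RV (normal_prob 0 1 : probability _ R) >-> R}) =
  EFin \o Phi.
Proof.
apply/funext => x; rewrite /= /Phi fineK//.
by apply: fin_num_measure.
Qed.

Lemma Phi_cvgNy : Phi x @[x --> -oo] --> (0 : R).
Proof.
have := cvg_cdfNy0 (idR : {RV (normal_prob 0 1 : probability _ R) >-> R}).
by rewrite cdf_normal => /fine_cvgP[].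
Qed.

Lemma Phi_cvgy : Phi x @[x --> +oo] --> (1 : R).
Proof.
have := cvg_cdfy1 (idR : {RV (normal_prob 0 1 : probability _ R) >-> R}).
by rewrite cdf_normal => /fine_cvgP[].
Qed.

Lemma Phi_ge0 x : 0 <= Phi x.
Proof. by rewrite fine_ge0. Qed.

(** [Phi x + Phi (- x)] has zero derivative, hence equals its limit [1] at
    [+oo]. *)
Lemma PhiN x : Phi (- x) = 1 - Phi x.
Proof.
pose S y := Phi y + Phi (- y).
have dS (y : R) : is_derive y 1 S 0.
  have dP := is_derive_Phi.
  apply: is_derive_eq; rewrite /= phiN; ring.
have SE (y : R) : S y = S x by apply: is_derive_0_is_cst.
have : S y @[y --> +oo] --> (1 + 0 : R).
  apply: cvgD; first exact: Phi_cvgy.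
  by have := Phi_cvgNy; rewrite cvgNy_compNP.
rewrite (_ : S = cst (S x)); last by apply/funext => y; rewrite SE.
move=> /(cvg_unique _ (cvg_cst _)); rewrite /S addr0 => <-//.
by rewrite addrAC subrr add0r.
Qed.

Lemma Phi_le1 x : Phi x <= 1.
Proof. by have := Phi_ge0 (- x); rewrite PhiN subr_ge0. Qed.

Lemma Phi0 : Phi 0 = 1 / 2.
Proof. by have := PhiN 0; rewrite oppr0; lra. Qed.

(** The Gaussian density and tail are at most a multiple of [expR], from
    [- x^2 / 2 <= x + 1 / 2]; this crude decay is enough for [ge0_of_decay]. *)
Let K : R := (Num.sqrt (2 * pi))^-1 * expR (1 / 2).

Lemma sqrt2pi_gt0 : 0 < Num.sqrt (2 * pi) :> R.
Proof. by rewrite sqrtr_gt0 mulr_gt0 ?pi_gt0. Qed.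

Lemma phi_le_exp x : phi x <= K * expR x.
Proof.
rewrite phiE /K -(mulrA _^-1) ler_wpM2l ?invr_ge0 ?sqrtr_ge0// -expRD ler_expR.
by have := sqr_ge0 (x + 1); rewrite sqrrD; lra.
Qed.

Lemma Phi_le_exp x : Phi x <= K * expR x.
Proof.
pose k y := K * expR y - Phi y.
have dk (y : R) : is_derive y 1 k (K * expR y - phi y).
  have dP := is_derive_Phi.
  by apply: is_derive_eq.
have kmono y : y <= x -> k y <= k x.
  apply: nondecreasing_derive dk _ => t _.
  by rewrite subr_ge0 phi_le_exp.
have K0 : 0 <= K by rewrite mulr_ge0 ?expR_ge0// invr_ge0 sqrtr_ge0.
rewrite -subr_ge0 -/(k x) leNgt; apply/negP => kx0.
near (ninfty_nbhs R) => y.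
have yx : y <= x by near: y; apply: nbhs_ninfty_le; rewrite num_real.
have : Phi y < - k x.
  by near: y; apply: cvgr_lt Phi_cvgNy _ _; rewrite oppr_gt0.
have := kmono _ yx; rewrite {1}/k.
have := mulr_ge0 K0 (expR_ge0 y).
lra.
Unshelve. all: by end_near. Qed.

Lemma sqr_exp_le y : y <= 0 -> y ^+ 2 * expR y <= 2.
Proof.
move=> y0; have := @expR_ge1Dxn R (- y) 1 ltac:(lra).
rewrite (_ : 2`!%:R = 2 :> R)// sqrrN => H.
have := expR_gt0 y; have : expR (- y) * expR y = 1 by rewrite -expRD addNr expR0.
nra.
Qed.

Lemma sqr_decay (u : R -> R) : (forall x, u x <= K * expR x) ->
  forall y, y < 0 -> y ^+ 2 * u y <= 2 * K.
Proof.
move=> uK y y0; apply: (@le_trans _ _ (y ^+ 2 * (K * expR y))).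
  by rewrite ler_wpM2l// sqr_ge0.
have K0 : 0 <= K by rewrite mulr_ge0 ?expR_ge0// invr_ge0 sqrtr_ge0.
have := sqr_exp_le (ltW y0); nra.
Qed.

(** The left-hand side is [E (x - Z)^+] for [Z] standard normal.  It is proved
    nonnegative by derivatives: its derivative is [Phi x]. *)
Lemma Phi_moment1_ge0 x : 0 <= x * Phi x + phi x.
Proof.
move: x; apply: (@ge0_of_decay _ _ Phi (2 * K)).
- move=> y; have dP := is_derive_Phi; have dp := is_derive_phi.
  by apply: is_derive_eq; rewrite /GRing.scale/=; ring.
- exact: Phi_ge0.
- move=> y y0; have := sqr_decay Phi_le_exp y0.
  by have := phi_gt0 y; nra.
Qed.

(** Likewise [E ((x - Z)^+)^2], whose derivative is twice the previous one. *)
Lemma Phi_moment2_ge0 x : 0 <= (1 + x ^+ 2) * Phi x + x * phi x.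
Proof.
move: x; apply: (@ge0_of_decay _ _ (fun x => 2 * (x * Phi x + phi x)) (2 * K)).
- move=> y; have dP := is_derive_Phi; have dp := is_derive_phi.
  by apply: is_derive_eq; rewrite /GRing.scale/=; ring.
- by move=> y; rewrite mulr_ge0// Phi_moment1_ge0.
- move=> y y0; have := sqr_decay phi_le_exp y0.
  have := mulr_ge0 (addr_ge0 ler01 (sqr_ge0 y)) (Phi_ge0 y); nra.
Qed.

(** The ratio [Phi / phi], which is the usual Mills ratio at [- x]; it satisfies
    [mills' = 1 + x * mills]. *)
Definition mills x : R := Num.sqrt (2 * pi) * expR (x ^+ 2 / 2) * Phi x.

Lemma phi_mills x : phi x * mills x = Phi x.
Proof.
rewrite phiE /mills expRN; field.
by rewrite !gt_eqF// ?sqrt2pi_gt0 ?expR_gt0.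
Qed.

Lemma mills_ge0 x : 0 <= mills x.
Proof. by rewrite -(pmulr_rge0 _ (phi_gt0 x)) phi_mills Phi_ge0. Qed.

Lemma is_derive_mills x : is_derive x 1 mills (1 + x * mills x).
Proof.
have dP := is_derive_Phi.
apply: is_derive_eq; rewrite /GRing.scale/= /mills phiE expRN; field.
by rewrite !gt_eqF// ?sqrt2pi_gt0 ?expR_gt0.
Qed.

Lemma mills_derive_ge0 x : 0 <= 1 + x * mills x.
Proof.
rewrite -(pmulr_rge0 _ (phi_gt0 x)) mulrDr mulrCA phi_mills.
by rewrite mulr1 addrC Phi_moment1_ge0.
Qed.

Lemma xmills_nondecreasing x y : x <= y -> x * mills x <= y * mills y.
Proof.
apply: (@nondecreasing_derive _ (fun t => t * mills t)
  (fun t => mills t + t * (1 + t * mills t))) => t.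
  by have dm := is_derive_mills; apply: is_derive_eq; rewrite /GRing.scale/=; ring.
move=> _; rewrite -(pmulr_rge0 _ (phi_gt0 t)).
have -> : phi t * (mills t + t * (1 + t * mills t)) =
    (1 + t ^+ 2) * (phi t * mills t) + t * phi t by ring.
by rewrite phi_mills Phi_moment2_ge0.
Qed.

(** Sharp at [x = 0].  For [x >= 0] the difference [G] of the two sides vanishes
    at [0] and at [+oo], and [G' = phi * q] where [q 0 = 0] and [q] is concave; so
    [G] increases and then decreases.  Formally, if [G] were negative somewhere,
    two applications of the mean value theorem would make [q] negative, hence
    [G] decreasing, from there on. *)
Lemma PhiPhiN_le x : Phi x * Phi (- x) <= expR (- (x ^+ 2 / 2)) / 4.
Proof.
suff pos (y : R) : 0 <= y -> Phi y * Phi (- y) <= expR (- (y ^+ 2 / 2)) / 4.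
  have [x0|x0] := leP 0 x; first exact: pos.
  by have := pos (- x) ltac:(lra); rewrite opprK sqrrN (mulrC (Phi _)).
move: y => z z0; rewrite PhiN.
pose c : R := Num.sqrt (2 * pi) / 4.
pose q (y : R) := 2 * Phi y - 1 - c * y.
pose dq (y : R) := 2 * phi y - c.
pose G (y : R) := c * phi y - Phi y * (1 - Phi y).
have dP := is_derive_Phi; have dp := is_derive_phi.
have GE y : expR (- (y ^+ 2 / 2)) / 4 - Phi y * (1 - Phi y) = G y.
  by rewrite /G /c phiE; field; rewrite gt_eqF ?sqrt2pi_gt0.
have qd (y : R) : is_derive y 1 q (dq y).
  apply: is_derive_eq; rewrite /GRing.scale/= /dq; ring.
have Gd (y : R) : is_derive y 1 G (phi y * q y).
  apply: is_derive_eq; rewrite /GRing.scale/= /q; ring.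
have q0 : q 0 = 0 by rewrite /q Phi0; lra.
have G0 : G 0 = 0.
  by rewrite -GE Phi0 expr0n/= mul0r oppr0 expR0; lra.
rewrite -subr_ge0 GE leNgt; apply/negP => Gz.
have {}z0 : 0 < z.
  rewrite lt_neqAle z0 andbT; apply/eqP => z0'.
  by rewrite -z0' G0 ltxx in Gz.
have mvt (k dk : R -> R) (u : R) : 0 < u -> (forall y : R, is_derive y 1 k (dk y)) ->
    k 0 = 0 -> k u < 0 -> exists2 v, 0 < v < u & dk v < 0.
  move=> u0 kd k0 ku.
  have [|v] := @MVT _ k dk 0 u u0 (fun y _ => kd y).
    exact/continuous_subspaceT/is_derive_continuous.
  rewrite in_itv/= k0 subr0 => v0u kuE; exists v => //.
  by move: ku; rewrite kuE subr0 pmulr_llt0.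
have [x' /andP[x0 xz] Gx] := mvt _ _ _ z0 Gd G0 Gz.
have qx : q x' < 0 by move: Gx; rewrite pmulr_rlt0 ?phi_gt0.
have [v /andP[v0 vx] dqv] := mvt _ _ _ x0 qd q0 qx.
have qneg y : x' <= y -> q y < 0.
  move=> xy; apply: le_lt_trans qx; rewrite -lerN2.
  apply: (@nondecreasing_derive _ (fun t => - q t) (fun t => - dq t)) => //.
  move=> t /andP[xt ty]; rewrite oppr_ge0; apply: le_trans (ltW dqv).
  rewrite /dq lerD2r ler_wpM2l// !phiE ler_wpM2l ?invr_ge0 ?sqrtr_ge0//.
  rewrite ler_expR lerN2 ler_pM2r// ler_sqr ?nnegrE; lra.
have Gneg y : z <= y -> G y <= G z.
  move=> zy; rewrite -lerN2.
  apply: (@nondecreasing_derive _ (fun t => - G t) (fun t => - (phi t * q t))) => //.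
  move=> t /andP[zt ty]; rewrite oppr_ge0 pmulr_rle0 ?phi_gt0//.
  by apply/ltW/qneg; lra.
have tail : (1 - Phi t) @[t --> +oo] --> (0 : R).
  rewrite -[X in _ --> X](subrr (1 : R)).
  by apply: cvgB; [exact: cvg_cst|exact: Phi_cvgy].
near (pinfty_nbhs R) => y.
have Gyz : G y <= G z by apply: Gneg; near: y; apply: nbhs_pinfty_ge; rewrite num_real.
have Gz1 : 1 - Phi y < - G z.
  by near: y; apply: cvgr_lt tail _ _; rewrite oppr_gt0.
have cphi : 0 <= c * phi y.
  by rewrite mulr_ge0 ?(ltW (phi_gt0 _))// divr_ge0 ?sqrtr_ge0.
have := Phi_le1 y; have := Phi_ge0 y; move: Gyz; rewrite {1}/G; nra.
Unshelve. all: by end_near. Qed.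

Lemma mills_PhiN_le x : mills x * Phi (- x) <= Num.sqrt (2 * pi) / 4.
Proof.
have -> : mills x * Phi (- x) =
    Num.sqrt (2 * pi) * (expR (x ^+ 2 / 2) * (Phi x * Phi (- x))).
  by rewrite /mills; ring.
rewrite ler_wpM2l ?sqrtr_ge0//.
apply: (@le_trans _ _ (expR (x ^+ 2 / 2) * (expR (- (x ^+ 2 / 2)) / 4))).
  by rewrite ler_wpM2l ?expR_ge0// PhiPhiN_le.
by rewrite mulrA -expRD subrr expR0 mul1r.
Qed.

(** [1.635] lies in [[0, pi/2)] if [pi > 3.27], but [cos] is already negative
    there, by the Taylor bound of order four. *)
Lemma pi_le : pi <= 327 / 100 :> R.
Proof.
rewrite leNgt; apply/negP => pi_gt.
have dsin := @is_derive_sin R; have dcos := @is_derive_cos R.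
have step (k dk : R -> R) : (forall x : R, is_derive x 1 k (dk x)) ->
    (forall x, 0 <= x -> 0 <= dk x) -> k 0 = 0 -> forall x, 0 <= x -> 0 <= k x.
  move=> kd dk0 k0 x x0; rewrite -k0.
  by apply: nondecreasing_derive kd _ x0 => t /andP[t0 _]; exact/dk0/ltW.
have sin1d (y : R) : is_derive y 1 (fun t => t - sin t) (1 - cos y).
  by apply: is_derive_eq.
have sin1 x : 0 <= x -> 0 <= x - sin x.
  apply: (step _ _ sin1d) => [y y0|]; first by rewrite subr_ge0 cos_le1.
  by rewrite sin0 subr0.
have cos2d (y : R) : is_derive y 1 (fun t => cos t - 1 + t ^+ 2 / 2) (y - sin y).
  by apply: is_derive_eq; rewrite /GRing.scale/=; field.
have cos2 x : 0 <= x -> 0 <= cos x - 1 + x ^+ 2 / 2.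
  apply: (step _ _ cos2d) => [y y0|]; first exact: sin1.
  by rewrite cos0; field.
have sin3d (y : R) :
    is_derive y 1 (fun t => sin t - t + t ^+ 3 / 6) (cos y - 1 + y ^+ 2 / 2).
  by apply: is_derive_eq; rewrite /GRing.scale/=; field.
have sin3 x : 0 <= x -> 0 <= sin x - x + x ^+ 3 / 6.
  apply: (step _ _ sin3d) => [y y0|]; first exact: cos2.
  by rewrite sin0; field.
have cos4d (y : R) :
    is_derive y 1 (fun t => 1 - t ^+ 2 / 2 + t ^+ 4 / 24 - cos t)
      (sin y - y + y ^+ 3 / 6).
  by apply: is_derive_eq; rewrite /GRing.scale/=; field.
have cos4 x : 0 <= x -> 0 <= 1 - x ^+ 2 / 2 + x ^+ 4 / 24 - cos x.
  apply: (step _ _ cos4d) => [y y0|]; first exact: sin3.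
  by rewrite cos0; field.
have h : 0 < cos (327 / 200 : R).
  by apply: cos_gt0_pihalf; have := @pi_gt0 R; lra.
have := cos4 (327 / 200) ltac:(lra); lra.
Qed.

Lemma sqrt2pi_le : Num.sqrt (2 * pi) <= 64 / 25 :> R.
Proof.
have h : 2 * pi <= (64 / 25) ^+ 2 :> R by have := pi_le; rewrite expr2; lra.
by rewrite (le_trans (ler_wsqrtr h))// sqrtr_sqr ger0_norm; lra.
Qed.

End std_normal.

(** * The solution of the Stein equation *)

Section stein.
Context {R : realType}.
Implicit Types x y z w : R.

Lemma mills_nondecreasing x y : x <= y -> mills x <= mills y.
Proof.
by apply: (nondecreasing_derive is_derive_mills) => t _; exact: mills_derive_ge0.
Qed.

(** This is [e^(w^2/2) * \int_(-oo)^w (1(x <= z) - Phi z) e^(-x^2/2) dx] with the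
    integral evaluated; the minimum makes continuity at [z] visible. *)
Definition stein_sol z w : R :=
  Num.sqrt (2 * pi) * expR (w ^+ 2 / 2) * (Phi (Num.min w z) - Phi z * Phi w).

(** At the kink [w = z] this is the left derivative. *)
Definition dstein_sol z w : R := w * stein_sol z w + (w <= z)%R%:R - Phi z.

Lemma stein_sol_le z w : w <= z -> stein_sol z w = Phi (- z) * mills w.
Proof. by move=> wz; rewrite /stein_sol (min_idPl wz) PhiN /mills; ring. Qed.

Lemma stein_sol_ge z w : z <= w -> stein_sol z w = Phi z * mills (- w).
Proof. by move=> zw; rewrite /stein_sol (min_idPr zw) /mills PhiN sqrrN; ring. Qed.

Lemma continuous_stein_sol z : continuous (stein_sol z).
Proof.
move=> w; have cexp : continuous (fun t : R => Num.sqrt (2 * pi) * expR (t ^+ 2 / 2)).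
  apply: (@is_derive_continuous _ _
    (fun t => t * (Num.sqrt (2 * pi) * expR (t ^+ 2 / 2)))) => t.
  by apply: is_derive_eq; rewrite /GRing.scale/=; field.
have cPhi := is_derive_continuous (@is_derive_Phi R).
apply: cvgM; first exact: cexp.
apply: cvgB; last by apply: cvgM; [exact: cvg_cst|exact: cPhi].
apply: (@continuous_comp _ _ _ (fun w => Num.min w z) Phi); last exact: cPhi.
by apply: continuous_min; [exact: cvg_id|exact: cvg_cst].
Qed.

Lemma is_derive_stein_sol z w : w != z -> is_derive w 1 (stein_sol z) (dstein_sol z w).
Proof.
have dm := @is_derive_mills R.
move=> /lt_total/orP[wz|zw].
- have h : {near w, (fun t => Phi (- z) * mills t) =1 stein_sol z}.
    near=> t; rewrite stein_sol_le//.
    by near: t; exact: (@cvgr_le _ _ (nbhs w) _ id w cvg_id z wz).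
  apply: (near_eq_is_derive h).
  rewrite /dstein_sol (ltW wz) stein_sol_le ?ltW//.
  by apply: is_derive_eq; rewrite /GRing.scale/= PhiN; ring.
- have h : {near w, (fun t => Phi z * mills (- t)) =1 stein_sol z}.
    near=> t; rewrite stein_sol_ge//.
    by near: t; exact: (@cvgr_ge _ _ (nbhs w) _ id w cvg_id z zw).
  apply: (near_eq_is_derive h).
  rewrite /dstein_sol leNgt zw stein_sol_ge ?ltW//.
  by apply: is_derive_eq; rewrite /GRing.scale/=; ring.
Unshelve. all: by end_near. Qed.

Lemma stein_sol_ge0 z w : 0 <= stein_sol z w.
Proof.
have [wz|/ltW zw] := leP w z.
  by rewrite stein_sol_le// mulr_ge0// ?mills_ge0 ?Phi_ge0.
by rewrite stein_sol_ge// mulr_ge0// ?mills_ge0 ?Phi_ge0.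
Qed.

(** [stein_sol z] increases up to [z] and decreases afterwards, and its maximum
    [mills z * Phi (- z)] is at most [sqrt (2 pi) / 4]. *)
Lemma stein_sol_ub z w : stein_sol z w <= Num.sqrt (2 * pi) / 4.
Proof.
have [wz|/ltW zw] := leP w z.
  rewrite stein_sol_le// (le_trans _ (mills_PhiN_le z))// mulrC.
  by rewrite ler_wpM2r ?Phi_ge0// mills_nondecreasing.
rewrite stein_sol_ge// (le_trans _ (mills_PhiN_le (- z)))// mulrC opprK.
by rewrite ler_wpM2r ?Phi_ge0// mills_nondecreasing// lerN2.
Qed.

(** On each side of [z] the derivative is a monotone function of [w] with a
    constant sign, so its extreme values are the two one-sided limits at [z];
    these differ by the jump of the indicator, which is one. *)
Lemma dstein_sol_itv z : exists2 a, 0 <= a <= 1 &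
  forall w, a - 1 <= dstein_sol z w <= a.
Proof.
have glue : Phi (- z) * mills z = Phi z * mills (- z).
  by rewrite -(stein_sol_le (lexx z)) (stein_sol_ge (lexx z)).
have Pz := Phi_ge0 z; have PNz := Phi_ge0 (- z).
pose a := Phi (- z) * (1 + z * mills z).
pose b := Phi z * (1 + - z * mills (- z)).
have ab : a + b = 1.
  have -> : a + b = Phi (- z) + Phi z + z * (Phi (- z) * mills z - Phi z * mills (- z)).
    by rewrite /a /b; ring.
  by rewrite glue subrr mulr0 addr0 PhiN subrK.
have a0 : 0 <= a by rewrite mulr_ge0 ?mills_derive_ge0.
have b0 : 0 <= b by rewrite mulr_ge0 ?mills_derive_ge0.
exists a; first by apply/andP; split; lra.
move=> w; have [wz|zw] := leP w z.
  have -> : dstein_sol z w = Phi (- z) * (1 + w * mills w).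
    by rewrite /dstein_sol wz stein_sol_le//= PhiN; ring.
  apply/andP; split.
    by rewrite (@le_trans _ _ 0)//; [lra|rewrite mulr_ge0 ?mills_derive_ge0].
  by rewrite /a ler_wpM2l// lerD2l xmills_nondecreasing.
have -> : dstein_sol z w = - (Phi z * (1 + - w * mills (- w))).
  by rewrite /dstein_sol leNgt zw stein_sol_ge ?ltW//=; ring.
apply/andP; split.
  rewrite (_ : a - 1 = - b); last by lra.
  by rewrite lerN2 /b ler_wpM2l// lerD2l xmills_nondecreasing// lerN2 ltW.
by rewrite (@le_trans _ _ 0)// oppr_le0 mulr_ge0 ?mills_derive_ge0.
Qed.

Opaque stein_sol.

Lemma stein_sol_slope z (a : R) : (forall w, a - 1 <= dstein_sol z w <= a) ->
  forall x y, x <= y ->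
    (a - 1) * (y - x) <= stein_sol z y - stein_sol z x <= a * (y - x).
Proof.
move=> az x y xy.
have cl (c : R) : continuous (fun t : R => c * t).
  apply: (is_derive_continuous (dk := fun=> c)) => t.
  by apply: is_derive_eq; rewrite /GRing.scale/=; ring.
have lo : stein_sol z x - (a - 1) * x <= stein_sol z y - (a - 1) * y.
  apply: (@nondecreasing_except _ z (fun t => stein_sol z t - (a - 1) * t)
    (fun t => dstein_sol z t - (a - 1))) => [|t|t _ tz]; first exact: xy.
    by apply: cvgB; [exact: continuous_stein_sol|exact: cl].
  split; last by have /andP[] := az t; lra.
  have ds := is_derive_stein_sol tz.
  by apply: is_derive_eq; rewrite /GRing.scale/=; ring.
have up : a * x - stein_sol z x <= a * y - stein_sol z y.
  apply: (@nondecreasing_except _ z (fun t => a * t - stein_sol z t)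
    (fun t => a - dstein_sol z t)) => [|t|t _ tz]; first exact: xy.
    by apply: cvgB; [exact: cl|exact: continuous_stein_sol].
  split; last by have /andP[] := az t; lra.
  have ds := is_derive_stein_sol tz.
  by apply: is_derive_eq; rewrite /GRing.scale/=; ring.
by apply/andP; split; lra.
Qed.

Lemma dstein_sol_norm z w : `|dstein_sol z w| <= 1.
Proof.
have [a a01 /(_ w)] := dstein_sol_itv z.
by rewrite ler_norml; lra.
Qed.

Lemma stein_sol_lipschitz z x y :
  `|stein_sol z y - stein_sol z x| <= `|y - x|.
Proof.
have [a a01 az] := dstein_sol_itv z.
wlog xy : x y / x <= y.
  move=> wl; have [/wl//|/ltW/wl] := leP x y.
  by rewrite distrC (distrC x).
have := stein_sol_slope az xy.
by rewrite (ger0_norm (_ : 0 <= y - x)) ?subr_ge0// ler_norml; nra.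
Qed.

Lemma stein_sol_taylor1 z x y :
  `|(y - x) * dstein_sol z x - (stein_sol z y - stein_sol z x)| <= `|y - x|.
Proof.
have [a a01 az] := dstein_sol_itv z.
have := az x; have [xy|/ltW yx] := leP x y.
  have := stein_sol_slope az xy.
  by rewrite (ger0_norm (_ : 0 <= y - x)) ?subr_ge0// ler_norml; nra.
have := stein_sol_slope az yx.
by rewrite (ler0_norm (_ : y - x <= 0)) ?subr_le0// ler_norml; nra.
Qed.

Lemma xstein_sol_lipschitz z x y :
  `|y * stein_sol z y - x * stein_sol z x|
    <= (`|x| + Num.sqrt (2 * pi) / 4) * `|y - x|.
Proof.
have -> : y * stein_sol z y - x * stein_sol z x =
  x * (stein_sol z y - stein_sol z x) + stein_sol z y * (y - x) by ring.
rewrite (le_trans (ler_normD _ _))// mulrDl (normrM x) (normrM (stein_sol z y)) lerD//.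
  by rewrite ler_wpM2l// stein_sol_lipschitz.
by rewrite ler_wpM2r// (ger0_norm (stein_sol_ge0 _ _)) stein_sol_ub.
Qed.

(** Comparison of [k] with a quadratic function: the derivative of
    [L * (t - x)^2 / 2 - s * (k t - k x - (t - x) * g x)] has the sign of [t - x],
    for [s = 1] and for [s = -1]. *)
Lemma taylor_except z (k g : R -> R) (L x : R) : continuous k ->
    (forall t, t != z -> is_derive t 1 k (g t)) ->
    (forall y, `|g y - g x| <= L * `|y - x|) ->
  forall y, `|k y - k x - (y - x) * g x| <= L * (y - x) ^+ 2 / 2.
Proof.
move=> kc kd gL.
have quad (s : R) : continuous (fun t : R => L * (t - x) ^+ 2 / 2 + s * (t - x) * g x).
  apply: (@is_derive_continuous _ _ (fun t => L * (t - x) + s * g x)) => t.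
  by apply: is_derive_eq; rewrite /GRing.scale/=; field.
have sgn (s : R) (y : R) : s ^+ 2 = 1 ->
    s * (k y - k x - (y - x) * g x) <= L * (y - x) ^+ 2 / 2.
  move=> s1.
  pose h t := L * (t - x) ^+ 2 / 2 + s * (t - x) * g x - s * k t.
  pose dh t := L * (t - x) - s * (g t - g x).
  have hc : continuous h.
    move=> t; apply: cvgB; first exact: quad.
    by apply: cvgM; [exact: cvg_cst|exact: kc].
  have hd t : t != z -> is_derive t 1 h (dh t).
    move=> tz; have dk := kd t tz.
    by apply: is_derive_eq; rewrite /GRing.scale/= /dh; field.
  have sgb t : s * (g t - g x) <= L * `|t - x| /\ - (s * (g t - g x)) <= L * `|t - x|.
    have := gL t; rewrite ler_norml => /andP[g1 g2].
    have /orP[/eqP ->|/eqP ->] : (s == 1) || (s == -1).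
      by rewrite -sqrf_eq1 s1.
      by split; lra.
    by split; lra.
  suff : h x <= h y by rewrite /h; lra.
  have [xy|/ltW yx] := leP x y.
    apply: (@nondecreasing_except _ z h dh) => [||t /andP[xt ty] tz].
    - exact: xy.
    - exact: hc.
    split; first exact: hd.
    have [+ _] := sgb t; rewrite gtr0_norm ?subr_gt0// /dh; lra.
  rewrite -lerN2.
  apply: (@nondecreasing_except _ z (fun t => - h t) (fun t => - dh t)) =>
    [|t|t /andP[yt tx] tz].
  - exact: yx.
  - by apply: cvgN; exact: hc.
  split.
    by have dht := hd _ tz; exact: is_derive_eq.
  have [_] := sgb t; rewrite ltr0_norm ?subr_lt0// /dh; lra.
move=> y; rewrite ler_norml; apply/andP; split.
  have := sgn (-1) y; rewrite sqrrN expr1n => /(_ erefl); lra.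
have := sgn 1 y; rewrite expr1n => /(_ erefl); lra.
Qed.

(** Removing [Num.min w z - Phi z * w] from the solution removes the kink: what
    remains has derivative [w * stein_sol z w], also at [z] from both sides. *)
Lemma stein_sol_taylor2 z x y :
  `|(stein_sol z y - Num.min y z + Phi z * y)
     - (stein_sol z x - Num.min x z + Phi z * x)
     - (y - x) * (x * stein_sol z x)|
  <= (`|x| + Num.sqrt (2 * pi) / 4) * (y - x) ^+ 2 / 2.
Proof.
apply: (@taylor_except z (fun t => stein_sol z t - Num.min t z + Phi z * t)
  (fun t => t * stein_sol z t)) => [t|t tz|t].
- apply: cvgD; last by apply: cvgM; [exact: cvg_cst|exact: cvg_id].
  apply: cvgB; first exact: continuous_stein_sol.
  by apply: continuous_min; [exact: cvg_id|exact: cvg_cst].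
- have df := is_derive_stein_sol tz.
  have dmin : is_derive t 1 (fun u : R => Num.min u z) (t <= z)%R%:R.
    move: (tz) => /lt_total/orP[lt_tz|lt_zt].
    + have h : {near t, id =1 (fun u => Num.min u z)}.
        near=> u; rewrite (min_idPl _)//.
        by near: u; exact: (@cvgr_le _ _ (nbhs t) _ id t cvg_id z lt_tz).
      by rewrite (ltW lt_tz); apply: (near_eq_is_derive h); exact: is_derive_id.
    + have h : {near t, cst z =1 (fun u => Num.min u z)}.
        near=> u; rewrite (min_idPr _)//.
        by near: u; exact: (@cvgr_ge _ _ (nbhs t) _ id t cvg_id z lt_zt).
      by rewrite leNgt lt_zt; apply: (near_eq_is_derive h); exact: is_derive_cst.
  by apply: is_derive_eq; rewrite /GRing.scale/= /dstein_sol; ring.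
- exact: xstein_sol_lipschitz.
Unshelve. all: by end_near. Qed.

(** This is [(y - x) * \int_x^y (f' x - f' t) dt] for [f = stein_sol z]. *)
Definition stein_rem z x y : R :=
  (y - x) ^+ 2 * dstein_sol z x - (y - x) * (stein_sol z y - stein_sol z x).

Lemma stein_rem_norm z x y : `|stein_rem z x y| <= (y - x) ^+ 2.
Proof.
rewrite /stein_rem expr2 -mulrA -mulrBr normrM -[leRHS]ger0_norm -?expr2 ?sqr_ge0//.
by rewrite expr2 normrM ler_wpM2l// stein_sol_taylor1.
Qed.

(** The squared jump from [x] to [y], kept only if it is at most [A] and starts in
    the window [[a, a + A]]. *)
Definition windowed_jump (A a x y : R) : R :=
  (y - x) ^+ 2 * ((`|y - x| <= A)%R && (a <= x <= a + A)%R)%:R.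

Definition large_jump (A x y : R) : R := (y - x) ^+ 2 * (A < `|y - x|)%R%:R.

Let smooth_bound (A x : R) := A ^+ 3 / 2 * (`|x| + Num.sqrt (2 * pi) / 4).

(** For a jump of size at most [A] the kink contributes only if the jump crosses
    [z]: upwards, from [[z - A, z]], with a nonnegative contribution; downwards,
    from [[z, z + A]], with a nonpositive one. *)
Lemma stein_rem_split z A x y : 0 <= A ->
  - (smooth_bound A x + windowed_jump A z x y + large_jump A x y) <= stein_rem z x y
    <= smooth_bound A x + windowed_jump A (z - A) x y + large_jump A x y.
Proof.
move=> A0.
have c0 : 0 <= Num.sqrt (2 * pi) / 4 :> R by rewrite divr_ge0 ?sqrtr_ge0.
have sb0 : 0 <= smooth_bound A x by rewrite mulr_ge0 ?addr_ge0 ?divr_ge0 ?exprn_ge0.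
have s0 := sqr_ge0 (y - x).
rewrite /windowed_jump /large_jump; have [yxA|Ayx] := leP `|y - x| A; last first.
  rewrite /= !mulr0n mulr1n !mulr0 !addr0 mulr1.
  have := stein_rem_norm z x y; rewrite ler_norml => /andP[? ?].
  by apply/andP; split; lra.
rewrite /= !mulr0n !mulr0 !addr0.
have : `|stein_rem z x y - ((y - x) ^+ 2 * (x <= z)%R%:R
                      - (y - x) * (Num.min y z - Num.min x z))| <= smooth_bound A x.
  (* after the kink is subtracted, the remainder of [stein_sol_taylor2] is left *)
  have -> : stein_rem z x y - ((y - x) ^+ 2 * (x <= z)%R%:R
                      - (y - x) * (Num.min y z - Num.min x z)) =
    - (y - x) * ((stein_sol z y - Num.min y z + Phi z * y)
     - (stein_sol z x - Num.min x z + Phi z * x)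
     - (y - x) * (x * stein_sol z x)).
    by rewrite /stein_rem /dstein_sol; ring.
  rewrite normrM normrN.
  apply: (@le_trans _ _ (A * ((`|x| + Num.sqrt (2 * pi) / 4) * A ^+ 2 / 2))).
    apply: ler_pM => //; apply: (le_trans (stein_sol_taylor2 _ _ _)).
    rewrite ler_wpM2r// ler_wpM2l ?addr_ge0//.
    by rewrite -real_normK ?num_real// ler_sqr ?nnegrE.
  by rewrite /smooth_bound le_eqVlt; apply/orP; left; apply/eqP; field.
move: yxA; rewrite !ler_norml => /andP[yx1 yx2] /andP[r1 r2].
set M := (y - x) ^+ 2 * _ - _ in r1 r2.
suff [M1 M2] : - ((y - x) ^+ 2 * (z <= x <= z + A)%R%:R) <= M /\
    M <= (y - x) ^+ 2 * (z - A <= x <= z - A + A)%R%:R.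
  by apply/andP; split; lra.
rewrite {r1 r2}/M subrK.
have [xz|zx] := leP x z; rewrite ?mulr1n ?mulr0n ?andbT ?andbF ?mulr0 ?mulr1.
  have [yz|zy] := leP y z.
    by rewrite -expr2 subrr mulr_ge0// oppr_le0 mulr_ge0.
  rewrite (_ : z - A <= x); last by lra.
  rewrite mulr1; split; last by nra.
  by rewrite (@le_trans _ _ 0)// ?oppr_le0 ?mulr_ge0//; nra.
rewrite (ltW zx)/=; have [yz|zy] := leP y z; last first.
  by rewrite subrr mulr0 subr0 oppr_le0 mulr_ge0.
rewrite (_ : x <= z + A); last by lra.
by rewrite mulr1; split; nra.
Qed.

(** Linear with slope one on [[a - A, a + 2 A]], which contains both ends of any
    jump counted by [windowed_jump A a], and constant outside; centring it gives
    the bound [3 A / 2]. *)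
Definition clip (A a w : R) : R :=
  Num.max (- (3 / 2 * A)) (Num.min (3 / 2 * A) (w - a - A / 2)).

Lemma clip_norm A a w : 0 <= A -> `|clip A a w| <= 3 / 2 * A.
Proof.
move=> A0; rewrite /clip ler_norml le_max lexx/= ge_max ge_min lexx/= andbT.
lra.
Qed.

Lemma clip_nondecreasing A a x y : x <= y -> clip A a x <= clip A a y.
Proof.
by move=> xy; rewrite /clip le_max2// le_min2//; lra.
Qed.

Lemma windowed_jump_le_clip A a x y : 0 <= A ->
  windowed_jump A a x y <= (y - x) * (clip A a y - clip A a x).
Proof.
move=> A0; rewrite /windowed_jump.
have [/and3P[+ ax xa]|_] := boolP (_ && _); last first.
  rewrite mulr0; have [xy|/ltW yx] := leP x y.
    by rewrite mulr_ge0 ?subr_ge0 ?clip_nondecreasing.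
  by rewrite mulr_le0 ?subr_le0 ?clip_nondecreasing.
rewrite ler_norml => /andP[yx1 yx2].
have clipE t : a - A <= t <= a + 2 * A -> clip A a t = t - a - A / 2.
  by move=> ta; rewrite /clip (min_idPr _) ?(max_idPr _); lra.
by rewrite /= mulr1 !clipE; lra.
Qed.

End stein.

(** * Means, conditional expectations and exchangeable pairs *)

Section expectation.
Context {d : measure_display} {T : measurableType d} {R : realType}.
Variable P : probability T R.
Implicit Types X Y : T -> R.

Definition L1 X := P.-integrable setT (EFin \o X).
Definition mean X : R := \int[P]_w X w.

Lemma L1_measurable X : L1 X -> measurable_fun setT X.
Proof. by move=> /measurable_int/measurable_EFinP. Qed.

Lemma L1_le X Y : measurable_fun setT X -> L1 Y -> (forall w, `|X w| <= `|Y w|) -> L1 X.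
Proof.
move=> mX iY XY; apply: le_integrable iY => //; first exact/measurable_EFinP.
by move=> w _; rewrite /= lee_fin.
Qed.

Lemma L1_cst (c : R) : L1 (cst c).
Proof. exact: finite_measure_integrable_cst. Qed.

Lemma L1D X Y : L1 X -> L1 Y -> L1 (fun w => X w + Y w).
Proof. exact: integrableD. Qed.

Lemma L1B X Y : L1 X -> L1 Y -> L1 (fun w => X w - Y w).
Proof. exact: integrableB. Qed.

Lemma L1Z (c : R) X : L1 X -> L1 (fun w => c * X w).
Proof. exact: integrableZl. Qed.

Lemma L1_norm X : L1 X -> L1 (fun w => `|X w|).
Proof. exact: integrable_norm. Qed.

Lemma L1_bounded_mul (M : R) (g : T -> R) X :
    measurable_fun setT g -> (forall w, `|g w| <= M) ->
  L1 X -> L1 (fun w => g w * X w).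
Proof.
move=> mg gM iX; apply: (@L1_le _ (fun w => M * X w)); last first.
- by move=> w; rewrite !normrM ler_wpM2r// (le_trans (gM w))// ler_norm.
- exact: L1Z.
- by apply: measurable_funM => //; exact: L1_measurable.
Qed.

Lemma meanD X Y : L1 X -> L1 Y -> mean (fun w => X w + Y w) = mean X + mean Y.
Proof. exact: RintegralD. Qed.

Lemma meanB X Y : L1 X -> L1 Y -> mean (fun w => X w - Y w) = mean X - mean Y.
Proof. exact: RintegralB. Qed.

Lemma meanZ (c : R) X : L1 X -> mean (fun w => c * X w) = c * mean X.
Proof. exact: RintegralZl. Qed.

Lemma mean_cst (c : R) : mean (cst c) = c.
Proof.
by rewrite /mean /Rintegral; have := expectation_cst P c; rewrite unlock => ->.
Qed.

Lemma le_mean X Y : L1 X -> L1 Y -> (forall w, X w <= Y w) -> mean X <= mean Y.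
Proof. by move=> iX iY XY; apply: le_Rintegral. Qed.

Lemma mean_norm_le X : L1 X -> `|mean X| <= mean (fun w => `|X w|).
Proof. exact: le_normr_Rintegral. Qed.

Lemma mean_expectation X : L1 X -> ((mean X)%:E = 'E_P[X])%E.
Proof. by move=> iX; rewrite unlock /mean /Rintegral fineK// integrable_fin_num. Qed.

Lemma eq_mean X Y : X =1 Y -> mean X = mean Y.
Proof. by move=> /funext ->. Qed.

Lemma mean_ae X Y : L1 X -> L1 Y -> {ae P, forall w, X w = Y w} -> mean X = mean Y.
Proof.
move=> iX iY XY; rewrite /mean /Rintegral; congr fine.
apply: ae_eq_integral => //.
- exact: measurable_int iX.
- exact: measurable_int iY.
- by apply: filterS XY => w /= ->.
Qed.

Lemma L1_ae X Y : measurable_fun setT Y -> {ae P, forall w, X w = Y w} -> L1 X -> L1 Y.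
Proof.
move=> mY XY iX; apply/integrableP; split; first exact/measurable_EFinP.
move/integrableP : (iX) => [mX].
rewrite [X in (X < _)%E -> _](_ : _ = \int[P]_w `|(Y w)%:E|)%E//.
apply: ae_eq_integral => //; try apply: measurableT_comp => //.
- exact/measurable_EFinP.
- by apply: filterS XY => w /= ->.
Qed.

Lemma L1_of_sqr X : measurable_fun setT X -> L1 (fun w => X w ^+ 2) -> L1 X.
Proof.
move=> mX iX2; apply: (@L1_le _ (fun w => 1 + X w ^+ 2)) => //.
  by apply: L1D => //; exact: (L1_cst 1).
move=> w; rewrite [leRHS]ger0_norm ?addr_ge0 ?sqr_ge0//.
by rewrite -[X w ^+ 2]real_normK ?num_real//; have := normr_ge0 (X w); nra.
Qed.

Lemma L1_finite X : measurable_fun setT X -> (forall w, 0 <= X w) ->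
  ('E_P[X] < +oo)%E -> L1 X.
Proof.
move=> mX X0; rewrite unlock => fX.
apply/integrableP; split; first exact/measurable_EFinP.
by under eq_integral => w _ do rewrite gee0_abs ?lee_fin//.
Qed.

(** Jensen's inequality, from [E (|X| - m)^2 >= 0] with [m = E |X|]; if [X] is not
    square integrable the right-hand side is [+oo]. *)
Lemma mean_norm_le_sqrt X : L1 X ->
  ((mean (fun w => `|X w|))%:E <= sqrte 'E_P[(fun w => X w ^+ 2)%R])%E.
Proof.
move=> iX; have mX := L1_measurable iX.
have mX2 : measurable_fun setT (fun w => X w ^+ 2) by exact: measurable_funX.
have [fin|] := ltP 'E_P[(fun w => X w ^+ 2)%R]%E +oo%E; last first.
  by rewrite leye_eq => /eqP -> /=; rewrite leey.
have iX2 : L1 (fun w => X w ^+ 2) by apply: L1_finite => // w; exact: sqr_ge0.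
have iN := L1_norm iX.
set m := mean _.
have m0 : 0 <= m by apply: Rintegral_ge0.
have sq : m ^+ 2 <= mean (fun w => X w ^+ 2).
  have := @le_mean (fun w => 2 * m * `|X w| - cst (m ^+ 2) w) _
    (L1B (L1Z (2 * m) iN) (L1_cst (m ^+ 2))) iX2.
  rewrite (meanB (L1Z (2 * m) iN) (L1_cst (m ^+ 2))) meanZ// mean_cst -/m => h.
  have : 2 * m * m - m ^+ 2 <= mean (fun w => X w ^+ 2).
    apply: h => w; rewrite /cst -[leRHS]real_normK ?num_real//.
    by have := sqr_ge0 (`|X w| - m); rewrite sqrrB; lra.
  lra.
rewrite -mean_expectation//= lee_fin.
by rewrite -[m]ger0_norm// -sqrtr_sqr ler_wsqrtr.
Qed.

(** Orthogonality to the indicators of sigma(Y) extends to bounded functions of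
    [Y] by halving: subtracting [M / 2] where [g >= 0] and adding [M / 2] where
    [g < 0] turns a bound [M] into [M / 2] without changing [E (g(Y) U)].  After
    [n] steps [|E (g(Y) U)| <= M * E |U| / 2^n]. *)
Lemma mean_orthogonal (Y : {RV P >-> R}) U : L1 U ->
    (forall B : set R, measurable B -> mean (fun w => \1_(Y @^-1` B) w * U w) = 0) ->
  forall (g : R -> R) (M : R), measurable_fun setT g -> (forall y, `|g y| <= M) ->
  mean (fun w => g (Y w) * U w) = 0.
Proof.
move=> iU ortho g M mg gM.
pose C := mean (fun w => `|U w|).
have mY : measurable_fun setT Y by exact: measurable_funPT.
have bound n : forall (g : R -> R) M, measurable_fun setT g -> (forall y, `|g y| <= M) ->
    `|mean (fun w => g (Y w) * U w)| <= M * C / 2 ^+ n.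
  elim: n => [|n IH] {mg gM M}g M mg gM.
    rewrite divr1.
    have igU : L1 (fun w => g (Y w) * U w).
      apply: (@L1_bounded_mul M (g \o Y)) iU; first exact: measurableT_comp.
      by move=> w; exact: gM.
    rewrite (le_trans (mean_norm_le igU))// /C -meanZ; last exact: L1_norm.
    apply: le_mean; first exact: L1_norm.
      by apply: L1Z; exact: L1_norm.
    by move=> w; rewrite normrM ler_wpM2r.
  pose B := g @^-1` `[0, +oo[.
  have mB : measurable B by rewrite -[B]setTI; exact: mg.
  pose h y := g y - (M * \1_B y - M / 2).
  have mh : measurable_fun setT h.
    apply: measurable_funB => //; apply: measurable_funB => //.
    by apply: measurable_funM => //; exact: measurable_indic.
  have hM y : `|h y| <= M / 2.
    have := gM y; rewrite /h indicE !ler_norml.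
    have [yB|yB] := boolP (y \in B).
      by move: yB; rewrite inE /B /= in_itv/= andbT => ? /andP[? ?]; rewrite mulr1; lra.
    move: yB; rewrite notin_setE /B /= in_itv/= andbT => /negP; rewrite -ltNge.
    by move=> ? /andP[? ?]; rewrite mulr0; lra.
  have := IH _ _ mh hM.
  have -> : mean (fun w => h (Y w) * U w) = mean (fun w => g (Y w) * U w).
    have ihU : L1 (fun w => h (Y w) * U w).
      apply: (@L1_bounded_mul (M / 2) (h \o Y)) iU; first exact: measurableT_comp.
      by move=> w; exact: hM.
    have mYB (D : set R) : measurable D -> measurable (Y @^-1` D).
      by move=> mD; rewrite -[X in measurable X]setTI; exact: mY.
    have i1U (D : set R) : measurable D -> L1 (fun w => \1_(Y @^-1` D) w * U w).
      move=> mD; apply: (@L1_bounded_mul 1) => //.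
        exact/measurable_indic/mYB.
      by move=> w; rewrite indicE; case: (_ \in _); rewrite ?normr1 ?normr0.
    have E : mean (fun w => g (Y w) * U w) = mean (fun w => h (Y w) * U w +
        (M * (\1_(Y @^-1` B) w * U w) - M / 2 * (\1_(Y @^-1` setT) w * U w))).
      apply: eq_mean => w; rewrite /h !indicE.
      have -> : (w \in Y @^-1` B) = (Y w \in B) by [].
      have -> : (w \in Y @^-1` setT) = true by exact/mem_set.
      by rewrite mulr1n; field.
    rewrite E meanD//; last by apply: L1B; apply: L1Z; exact: i1U.
    rewrite meanB; [|apply: L1Z; exact: i1U|apply: L1Z; exact: i1U].
    rewrite !meanZ ?ortho//; [|exact: i1U|exact: i1U].
    by rewrite !mulr0 subr0 addr0.
  by rewrite exprS invfM; lra.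
apply/eqP; rewrite -normr_le0 leNgt; apply/negP => E0.
set e := `|_| in E0.
pose n := (Num.truncn (M * C / e)).+1.
have : M * C / e < n%:R by exact: truncnS_gt.
have n2 : (n%:R : R) <= 2 ^+ n by rewrite -natrX ler_nat ltnW// ltn_expl.
have := bound n g M mg gM; rewrite -/e.
rewrite ler_pdivlMr ?exprn_gt0// ltr_pdivrMr// => up lo.
have : n%:R * e <= 2 ^+ n * e by rewrite ler_wpM2r// ltW.
by move/(lt_le_trans lo); rewrite ltNge [X in ~~ (X <= _)]mulrC up.
Qed.

(** Orthogonality of [X - E(X | Y)] to the bounded functions of [Y]. *)
Lemma condexp_pullout (X V : T -> R) (Y : {RV P >-> R}) (g : R -> R) (M : R) :
    L1 X -> is_condexp X Y V -> measurable_fun setT g -> (forall y, `|g y| <= M) ->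
  mean (fun w => g (Y w) * X w) = mean (fun w => g (Y w) * V w).
Proof.
move=> iX [_ iV XV] mg gM.
have mY : measurable_fun setT Y by exact: measurable_funPT.
have mgY : measurable_fun setT (g \o Y) by exact: measurableT_comp.
have iU : L1 (fun w => X w - V w) by exact: L1B.
have i1 (U : T -> R) : L1 U -> L1 (fun w => g (Y w) * U w).
  by apply: (@L1_bounded_mul M (g \o Y)) => // w; exact: gM.
apply/eqP; rewrite -subr_eq0 -meanB; [|exact: i1|exact: i1].
apply/eqP.
transitivity (mean (fun w => g (Y w) * (X w - V w))).
  by apply: eq_mean => w; rewrite mulrBr.
apply: (@mean_orthogonal Y _ iU _ g M) => // B mB.
have mYB : measurable (Y @^-1` B).
  by rewrite -[X in measurable X]setTI; exact: mY.
have indic_mean (U : T -> R) :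
    mean (fun w => \1_(Y @^-1` B) w * U w) = \int[P]_(w in Y @^-1` B) U w.
  rewrite Rintegral_mkcond; apply: eq_mean => w.
  by rewrite patchE indicE; case: ifPn => _; rewrite ?mul1r ?mul0r.
rewrite indic_mean RintegralB//; try exact: integrableS iX || exact: integrableS iV.
rewrite /Rintegral XV ?subrr//.
by exists B => //; rewrite setTI.
Qed.

(** Swapping the coordinates preserves the joint law and changes the sign. *)
Lemma exchangeable_antisym (W W' : {RV P >-> R}) (G : R * R -> R) :
    exchangeable P W W' -> measurable_fun setT G ->
    (forall x y, G (y, x) = - G (x, y)) ->
    L1 (fun w => G (W w, W' w)) -> mean (fun w => G (W w, W' w)) = 0.
Proof.
move=> exch mG anti iG.
have mW : measurable_fun setT W by exact: measurable_funPT.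
have mW' : measurable_fun setT W' by exact: measurable_funPT.
have m1 : measurable_fun setT (fun w => (W w, W' w)) by exact: measurable_fun_pair.
have m2 : measurable_fun setT (fun w => (W' w, W w)) by exact: measurable_fun_pair.
have iG' : L1 (fun w => G (W' w, W w)).
  rewrite (_ : (fun w => _) = fun w => (-1) * G (W w, W' w)); first exact: L1Z.
  by apply/funext => w; rewrite anti mulN1r.
have swap : mean (fun w => G (W w, W' w)) = mean (fun w => G (W' w, W w)).
  congr fine; have mEG : measurable_fun setT (EFin \o G) by exact/measurable_EFinP.
  have e1 := @integral_pushforward _ _ _ _ _ _ m1 P setT _ mEG iG measurableT.
  have e2 := @integral_pushforward _ _ _ _ _ _ m2 P setT _ mEG iG' measurableT.
  transitivity (\int[pushforward P (fun w => (W w, W' w))]_p (G p)%:E)%E => //.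
  rewrite [LHS](@eq_measure_integral _ _ _ _ (pushforward P (fun w => (W' w, W w)))) //.
  by move=> B mB _; exact: exch.
have : mean (fun w => G (W' w, W w)) = - mean (fun w => G (W w, W' w)).
  by rewrite -mulN1r -meanZ//; apply: eq_mean => w; rewrite anti mulN1r.
rewrite -swap; lra.
Qed.

End expectation.

(** * Measurability *)

Lemma measurable_fun_bool_natr {d : measure_display} {T : measurableType d}
    {R : realType} (b : T -> bool) :
  measurable_fun setT b -> measurable_fun setT (fun w => (b w)%:R : R).
Proof.
move=> mb; rewrite (_ : (fun w => _) = fun w => if b w then (1 : R) else 0).
  exact: measurable_fun_ifT.
by apply/funext => w; case: (b w).
Qed.

Section measurability.
Context {d : measure_display} {T : measurableType d} {R : realType}.

Lemma measurable_stein_sol (z : R) : measurable_fun setT (stein_sol z).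
Proof. by apply: continuous_measurable_fun; exact: continuous_stein_sol. Qed.

Lemma measurable_dstein_sol (z : R) : measurable_fun setT (dstein_sol z).
Proof.
apply: measurable_funB => //; apply: measurable_funD.
  by apply: measurable_funM => //; exact: measurable_stein_sol.
by apply: measurable_fun_bool_natr; exact: measurable_fun_ler.
Qed.

Lemma measurable_windowed_jump (A a : R) (X Y : T -> R) :
  measurable_fun setT X -> measurable_fun setT Y ->
  measurable_fun setT (fun w => windowed_jump A a (X w) (Y w)).
Proof.
move=> mX mY; apply: measurable_funM.
  by apply: measurable_funX; exact: measurable_funB.
apply: measurable_fun_bool_natr; apply: measurable_and.
  apply: measurable_fun_ler => //.
  by apply: measurableT_comp => //; exact: measurable_funB.
by apply: measurable_and; exact: measurable_fun_ler.
Qed.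

Lemma measurable_large_jump (A : R) (X Y : T -> R) :
  measurable_fun setT X -> measurable_fun setT Y ->
  measurable_fun setT (fun w => large_jump A (X w) (Y w)).
Proof.
move=> mX mY; apply: measurable_funM.
  by apply: measurable_funX; exact: measurable_funB.
apply: measurable_fun_bool_natr; apply: measurable_fun_ltr => //.
by apply: measurableT_comp => //; exact: measurable_funB.
Qed.

Lemma measurable_clip (A a : R) : measurable_fun setT (clip A a).
Proof.
apply: measurable_maxr => //; apply: measurable_minr => //.
by apply: measurable_funB => //; apply: measurable_funB.
Qed.

End measurability.

(** * The normal approximation bound *)

Section exchangeable_pair.
Context {d : measure_display} {T : measurableType d} {R : realType}.
Variables (P : probability T R) (W W' : {RV P >-> R}).
Hypothesis exch : exchangeable P W W'.
Variables (lambda : R) (r : R -> R).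
Hypothesis lambda0 : 0 < lambda.
Hypothesis mr : measurable_fun setT r.
Hypothesis reg : {ae P, forall w, 'E_P[W' | W] w = (1 - lambda) * W w + r (W w)}.
Hypothesis W2 : ('E_P[(fun w => W w ^+ 2)%R] <= 1)%E.

Local Notation E := (mean P).

Let mW : measurable_fun setT W. Proof. exact: measurable_funPT. Qed.
Let mW' : measurable_fun setT W'. Proof. exact: measurable_funPT. Qed.

Lemma L1_Wsqr : L1 P (fun w => W w ^+ 2).
Proof.
apply: L1_finite => [|w|]; [exact: measurable_funX|exact: sqr_ge0|].
by rewrite (le_lt_trans W2)// ltry.
Qed.

Lemma L1_W : L1 P W. Proof. exact: L1_of_sqr mW L1_Wsqr. Qed.

Lemma L1_W'sqr : L1 P (fun w => W' w ^+ 2).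
Proof.
have m1 : measurable_fun setT (fun w => (W w, W' w)) by exact: measurable_fun_pair.
have m2 : measurable_fun setT (fun w => (W' w, W w)) by exact: measurable_fun_pair.
pose G (p : R * R) := (p.1 ^+ 2)%:E.
have mG : measurable_fun setT G.
  by apply/measurable_EFinP; apply: measurable_funX; exact: measurable_fst.
have iG : (pushforward P (fun w => (W w, W' w))).-integrable setT G.
  exact: (@integrable_pushforward _ _ _ _ _ _ m1 P setT G mG L1_Wsqr measurableT).
apply: L1_finite => [|w|]; [exact: measurable_funX|exact: sqr_ge0|].
rewrite unlock.
rewrite [X in (X < _)%E](_ : _ =
  \int[pushforward P (fun w => (W' w, W w))]_p G p)%E; last first.
  by rewrite ge0_integral_pushforward// => p _; rewrite lee_fin sqr_ge0.
rewrite -(@eq_measure_integral _ _ _ _ _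
  (pushforward P (fun w => (W w, W' w)))); last first.
  by move=> B mB _; exact: exch.
exact: integrable_lty.
Qed.

Lemma L1_W' : L1 P W'. Proof. exact: L1_of_sqr mW' L1_W'sqr. Qed.

Lemma L1_Dsqr : L1 P (fun w => (W' w - W w) ^+ 2).
Proof.
apply: (@L1_le _ _ _ P _ (fun w => 2 * W' w ^+ 2 + 2 * W w ^+ 2)).
- by apply: measurable_funX; exact: measurable_funB.
- by apply: L1D; apply: L1Z; [exact: L1_W'sqr|exact: L1_Wsqr].
- move=> w; rewrite (ger0_norm (sqr_ge0 _)) (le_trans _ (ler_norm _))//.
  by have := sqr_ge0 (W' w + W w); rewrite sqrrB sqrrD; lra.
Qed.

Let V' := condexp W' W.
Let condV' : is_condexp W' W V'. Proof. exact/condexpP/L1_W'. Qed.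

Lemma L1_rW : L1 P (r \o W).
Proof.
have [_ iV' _] := condV'.
apply: (@L1_ae _ _ _ P (fun w => V' w - (1 - lambda) * W w)).
- exact: measurableT_comp.
- by apply: filterS reg => w; rewrite -/V' => ->/=; ring.
- by apply: L1B => //; apply: L1Z; exact: L1_W.
Qed.

(** [(y - x) * (f y - f x)] differs from the antisymmetric
    [(y - x) * (f x + f y)] by [- 2 * (y - x) * f x], and the mean of the latter at
    [(W, W')] is given by the regression equation. *)
Lemma stein_exchangeable (f : R -> R) (M : R) : measurable_fun setT f ->
    (forall x, `|f x| <= M) ->
  E (fun w => (W' w - W w) * (f (W' w) - f (W w))) =
  2 * (lambda * E (fun w => f (W w) * W w) - E (fun w => f (W w) * r (W w))).
Proof.
move=> mf fM.
have [_ iV' _] := condV'.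
have iW := L1_W; have iW' := L1_W'; have irW := L1_rW.
have mfW : measurable_fun setT (fun w => f (W w)) by exact: measurableT_comp.
have mfW' : measurable_fun setT (fun w => f (W' w)) by exact: measurableT_comp.
have ib (X : T -> R) : L1 P X -> L1 P (fun w => f (W w) * X w).
  by apply: (@L1_bounded_mul _ _ _ _ M) => // w.
have iD : L1 P (fun w => W' w - W w) by exact: L1B.
have iS : L1 P (fun w => (W' w - W w) * (f (W w) + f (W' w))).
  rewrite (_ : (fun w => _) = fun w => (f (W w) + f (W' w)) * (W' w - W w)); last first.
    by apply/funext => w; rewrite mulrC.
  apply: (@L1_bounded_mul _ _ _ _ (M + M)) => //; first exact: measurable_funD.
  by move=> w; rewrite (le_trans (ler_normD _ _))// lerD.
have S0 : E (fun w => (W' w - W w) * (f (W w) + f (W' w))) = 0.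
  apply: (@exchangeable_antisym _ _ _ P W W'
    (fun p => (p.2 - p.1) * (f p.1 + f p.2))) => //.
    apply: measurable_funM; first exact: measurable_funB.
    by apply: measurable_funD; exact: measurableT_comp.
  by move=> x y /=; ring.
have pull : E (fun w => f (W w) * W' w) =
    (1 - lambda) * E (fun w => f (W w) * W w) + E (fun w => f (W w) * r (W w)).
  rewrite (condexp_pullout iW' condV' mf fM) -meanZ; last exact: ib.
  rewrite -meanD; [|by apply: L1Z; exact: ib|exact: ib].
  apply: mean_ae; first exact: ib.
    by apply: L1D; [apply: L1Z|]; exact: ib.
  by apply: filterS reg => w; rewrite -/V' => ->; ring.
transitivity (E (fun w => (W' w - W w) * (f (W w) + f (W' w)) -
    2 * (f (W w) * W' w - f (W w) * W w))).
  by apply: eq_mean => w; ring.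
rewrite meanB//; last by apply: L1Z; apply: L1B; exact: ib.
rewrite meanZ; last by apply: L1B; exact: ib.
rewrite meanB; [|exact: ib|exact: ib].
by rewrite S0 pull; ring.
Qed.

Let V := condexp (fun u => (W' u - W u) ^+ 2) W.
Let condV : is_condexp (fun u => (W' u - W u) ^+ 2) W V.
Proof. exact/condexpP/L1_Dsqr. Qed.

Let iW : L1 P W. Proof. exact: L1_W. Qed.
Let iD2 : L1 P (fun w => (W' w - W w) ^+ 2). Proof. exact: L1_Dsqr. Qed.
Let irW : L1 P (r \o W). Proof. exact: L1_rW. Qed.
Let iV : L1 P V. Proof. by have [] := condV. Qed.

Lemma mean_bounded_mul_le (f : R -> R) (M : R) (X : T -> R) :
    measurable_fun setT f -> (forall x, `|f x| <= M) -> L1 P X ->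
  `|E (fun w => f (W w) * X w)| <= M * E (fun w => `|X w|).
Proof.
move=> mf fM iX.
have mfW : measurable_fun setT (fun w => f (W w)) by exact: measurableT_comp.
have ifX : L1 P (fun w => f (W w) * X w).
  by apply: (@L1_bounded_mul _ _ _ _ M) => // w.
rewrite (le_trans (mean_norm_le ifX))// -meanZ; last exact: L1_norm.
apply: le_mean; [exact: L1_norm|by apply: L1Z; exact: L1_norm|].
by move=> w; rewrite normrM ler_wpM2r.
Qed.

Lemma L1_windowed_jump A a : L1 P (fun w => windowed_jump A a (W w) (W' w)).
Proof.
apply: L1_le iD2 _; first exact: measurable_windowed_jump.
move=> w; rewrite /windowed_jump normrM ler_piMr// normr_nat.
by case: (_ && _); rewrite ?ler01 ?lexx.
Qed.

Lemma L1_large_jump A : L1 P (fun w => large_jump A (W w) (W' w)).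
Proof.
apply: L1_le iD2 _; first exact: measurable_large_jump.
move=> w; rewrite /large_jump normrM ler_piMr// normr_nat.
by case: (_ < _)%R; rewrite ?ler01 ?lexx.
Qed.

Lemma L1_increment (f : R -> R) (M : R) : measurable_fun setT f ->
    (forall x, `|f x| <= M) ->
  L1 P (fun w => (W' w - W w) * (f (W' w) - f (W w))).
Proof.
move=> mf fM.
rewrite (_ : (fun w => _) = fun w => (f (W' w) - f (W w)) * (W' w - W w)); last first.
  by apply/funext => w; rewrite mulrC.
apply: (@L1_bounded_mul _ _ _ _ (M + M)).
- by apply: measurable_funB; exact: measurableT_comp.
- by move=> w; rewrite (le_trans (ler_normB _ _))// lerD.
- by apply: L1B => //; exact: L1_W'.
Qed.

(** [windowed_jump] is at most the increment product of [clip], whose mean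
    [stein_exchangeable] computes; [clip] is bounded by [3 A / 2]. *)
Lemma concentration A a : 0 <= A ->
  E (fun w => windowed_jump A a (W w) (W' w)) <=
  3 * A * (lambda * E (fun w => `|W w|) + E (fun w => `|r (W w)|)).
Proof.
move=> A0.
have mc := @measurable_clip R A a.
have cA x := clip_norm a x A0.
apply: (@le_trans _ _ (E (fun w =>
    (W' w - W w) * (clip A a (W' w) - clip A a (W w))))).
  apply: le_mean; [exact: L1_windowed_jump|exact: L1_increment cA|].
  by move=> w; exact: windowed_jump_le_clip.
rewrite (stein_exchangeable mc cA).
have := mean_bounded_mul_le mc cA iW; have := mean_bounded_mul_le mc cA irW.
rewrite !ler_norml => /andP[h1 _] /andP[_ h2].
have : lambda * E (fun w => clip A a (W w) * W w) <=
    lambda * (3 / 2 * A * E (fun w => `|W w|)) by rewrite ler_wpM2l// ltW.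
move: h1; rewrite /=; lra.
Qed.

Lemma EW_le1 : E (fun w => `|W w|) <= 1.
Proof.
rewrite -lee_fin (le_trans (mean_norm_le_sqrt iW))//.
rewrite -(_ : sqrte 1 = 1)%E ?lee_sqrt//; last by rewrite /= sqrtr1.
Qed.

Lemma L1_stein_rem z : L1 P (fun w => stein_rem z (W w) (W' w)).
Proof.
apply: L1_le iD2 _ => [|w].
  apply: measurable_funB.
    apply: measurable_funM.
      by apply: measurable_funX; exact: measurable_funB.
    by apply: measurableT_comp => //; exact: measurable_dstein_sol.
  apply: measurable_funM; first exact: measurable_funB.
  by apply: measurable_funB; apply: measurableT_comp => //; exact: measurable_stein_sol.
by rewrite (le_trans (stein_rem_norm _ _ _))// ler_norm.
Qed.

(** The expectation of [stein_rem_split], with [E |W| <= 1] and [concentration]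
    on the window below [z] for the upper bound and above [z] for the lower. *)
Lemma mean_stein_rem_norm A z : 0 <= A ->
  `|E (fun w => stein_rem z (W w) (W' w))| <=
    A ^+ 3 / 2 * (1 + Num.sqrt (2 * pi) / 4)
    + 3 * A * (lambda + E (fun w => `|r (W w)|))
    + E (fun w => large_jump A (W w) (W' w)).
Proof.
move=> A0.
pose c : R := Num.sqrt (2 * pi) / 4.
have iS : L1 P (fun w => A ^+ 3 / 2 * (`|W w| + c)).
  by apply: L1Z; apply: L1D; [exact: L1_norm|exact: L1_cst].
have A3 : 0 <= A ^+ 3 / 2 by rewrite divr_ge0 ?exprn_ge0.
have bound a : E (fun w => A ^+ 3 / 2 * (`|W w| + c) + windowed_jump A a (W w) (W' w)
      + large_jump A (W w) (W' w)) <=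
    A ^+ 3 / 2 * (1 + c) + 3 * A * (lambda + E (fun w => `|r (W w)|))
    + E (fun w => large_jump A (W w) (W' w)).
  rewrite meanD; [|by apply: L1D => //; exact: L1_windowed_jump|exact: L1_large_jump].
  rewrite lerD2r meanD//; last exact: L1_windowed_jump.
  apply: lerD.
    rewrite meanZ; last by apply: L1D; [exact: L1_norm|exact: L1_cst].
    rewrite ler_wpM2l// meanD; [|exact: L1_norm|exact: L1_cst].
    by rewrite mean_cst lerD2r EW_le1.
  rewrite (le_trans (concentration a A0))// ler_wpM2l ?mulr_ge0//.
  by rewrite lerD2r ler_piMr ?EW_le1// ltW.
have iB a : L1 P (fun w => A ^+ 3 / 2 * (`|W w| + c) + windowed_jump A a (W w) (W' w)
      + large_jump A (W w) (W' w)).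
  by apply: L1D; [apply: L1D => //; exact: L1_windowed_jump|exact: L1_large_jump].
have iR := L1_stein_rem z.
rewrite ler_norml; apply/andP; split.
  rewrite lerNl (le_trans _ (bound z))// -mulN1r -meanZ//.
  apply: le_mean => //; first exact: L1Z.
  move=> w; rewrite mulN1r lerNl.
  by have /andP[] := stein_rem_split z (W w) (W' w) A0.
rewrite (le_trans _ (bound (z - A)))//; apply: le_mean => // w.
by have /andP[] := stein_rem_split z (W w) (W' w) A0.
Qed.

Lemma cdf_mean z : (cdf W z = (E (fun w => (W w <= z)%R%:R))%:E)%E.
Proof.
have mB : measurable (W @^-1` `]-oo, z]).
  by rewrite -[X in measurable X]setTI; exact: mW.
rewrite [LHS](_ : _ = P (W @^-1` `]-oo, z]))// -expectation_indic//.
rewrite -mean_expectation; last first.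
  apply: (@L1_le _ _ _ _ _ (cst 1)); [exact: measurable_indic|exact: L1_cst|].
  by move=> w; rewrite indicE normr1; case: (_ \in _); rewrite ?normr1 ?normr0.
congr (_%:E); apply: eq_mean => w; rewrite indicE; congr ((nat_of_bool _)%:R).
apply/idP/idP; first by rewrite inE/= in_itv.
by move=> h; rewrite inE/= in_itv.
Qed.

(** Stein's decomposition of [P(W <= z) - Phi z] into the conditional variance
    term, the remainder and the regression error, with the constants collected. *)
Lemma stein_bound A z : 0 <= A ->
  `|E (fun w => (W w <= z)%R%:R) - Phi z| <=
    E (fun w => `|1 - (2 * lambda)^-1 * V w|)
    + (Num.sqrt (2 * pi) / 4 + 3 / 2 * A) * (E (fun w => `|r (W w)|) * lambda^-1)
    + 41 / 100 * A ^+ 3 / lambda + 3 / 2 * A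
    + (2 * lambda)^-1 * E (fun w => large_jump A (W w) (W' w)).
Proof.
move=> A0.
pose c : R := Num.sqrt (2 * pi) / 4.
have mf := @measurable_stein_sol R z.
have mdf := @measurable_dstein_sol R z.
have fc x : `|stein_sol z x| <= c.
  by rewrite ger0_norm ?stein_sol_ub// stein_sol_ge0.
have df1 := dstein_sol_norm z.
have mfW : measurable_fun setT (fun w => stein_sol z (W w)) by exact: measurableT_comp.
have mdfW : measurable_fun setT (fun w => dstein_sol z (W w)) by exact: measurableT_comp.
have ifb (X : T -> R) : L1 P X -> L1 P (fun w => stein_sol z (W w) * X w).
  by apply: (@L1_bounded_mul _ _ _ _ c).
have idfb (X : T -> R) : L1 P X -> L1 P (fun w => dstein_sol z (W w) * X w).
  by apply: (@L1_bounded_mul _ _ _ _ 1).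
have ind : L1 P (fun w => (W w <= z)%R%:R : R).
  apply: (@L1_le _ _ _ _ _ (cst 1)); [|exact: L1_cst|].
    by apply: measurable_fun_bool_natr; exact: measurable_fun_ler.
  move=> w; rewrite /cst normr1.
  by case: (W w <= z)%R; rewrite ?mulr1n ?mulr0n ?normr1 ?normr0.
have iU : L1 P (fun w => 1 - (2 * lambda)^-1 * V w).
  by apply: L1B; [exact: L1_cst|exact: L1Z].
have iR := L1_stein_rem z.
have eq1 : E (fun w => (W w <= z)%R%:R) - Phi z =
    E (fun w => dstein_sol z (W w) * 1) - E (fun w => stein_sol z (W w) * W w).
  rewrite -meanB; [|by apply: idfb; exact: L1_cst|exact: ifb].
  rewrite -[Phi z in LHS](mean_cst P) -meanB//; last exact: L1_cst.
  by apply: eq_mean => w; rewrite /cst /dstein_sol; ring.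
have eq2 : E (fun w => dstein_sol z (W w) * (1 - (2 * lambda)^-1 * V w)) =
    E (fun w => dstein_sol z (W w) * 1)
    - (2 * lambda)^-1 * E (fun w => dstein_sol z (W w) * (W' w - W w) ^+ 2).
  rewrite (condexp_pullout iD2 condV mdf df1) -meanZ; last exact: idfb.
  rewrite -meanB; [|by apply: idfb; exact: L1_cst|by apply: L1Z; exact: idfb].
  by apply: eq_mean => w; ring.
have eq3 : E (fun w => stein_rem z (W w) (W' w)) =
    E (fun w => dstein_sol z (W w) * (W' w - W w) ^+ 2) -
    2 * (lambda * E (fun w => stein_sol z (W w) * W w)
         - E (fun w => stein_sol z (W w) * r (W w))).
  rewrite -(stein_exchangeable mf fc).
  rewrite -meanB; [|exact: idfb|exact: L1_increment fc].
  by apply: eq_mean => w; rewrite /stein_rem [(_ ^+ 2) * _]mulrC.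
have lam0 : lambda != 0 by rewrite gt_eqF.
have -> : E (fun w => (W w <= z)%R%:R) - Phi z =
    E (fun w => dstein_sol z (W w) * (1 - (2 * lambda)^-1 * V w))
    + (2 * lambda)^-1 * E (fun w => stein_rem z (W w) (W' w))
    - lambda^-1 * E (fun w => stein_sol z (W w) * r (W w)).
  by rewrite eq1 eq2 eq3; field.
have b1 := mean_bounded_mul_le mdf df1 iU.
have b2 := mean_stein_rem_norm z A0.
have b3 := mean_bounded_mul_le mf fc irW.
rewrite mul1r in b1.
have il0 : 0 <= lambda^-1 by rewrite invr_ge0 ltW.
have i2l0 : 0 <= (2 * lambda)^-1 by rewrite invr_ge0 mulr_ge0 ?ltW.
have c41 : (1 + c) / 4 <= 41 / 100 by have := @sqrt2pi_le R; rewrite /c; lra.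
rewrite (le_trans (ler_normB _ _))// (le_trans (lerD (ler_normD _ _) (lexx _)))//.
rewrite (normrM (2 * lambda)^-1) (normrM lambda^-1) !(ger0_norm il0, ger0_norm i2l0).
apply: (@le_trans _ _ (E (fun w => `|1 - (2 * lambda)^-1 * V w|)
  + (2 * lambda)^-1 * (A ^+ 3 / 2 * (1 + c)
    + 3 * A * (lambda + E (fun w => `|r (W w)|))
    + E (fun w => large_jump A (W w) (W' w)))
  + lambda^-1 * (c * E (fun w => `|r (W w)|)))).
  by apply: lerD; [apply: lerD => //|]; rewrite ler_wpM2l.
have -> : E (fun w => `|1 - (2 * lambda)^-1 * V w|)
  + (2 * lambda)^-1 * (A ^+ 3 / 2 * (1 + c)
    + 3 * A * (lambda + E (fun w => `|r (W w)|))
    + E (fun w => large_jump A (W w) (W' w)))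
  + lambda^-1 * (c * E (fun w => `|r (W w)|)) =
  E (fun w => `|1 - (2 * lambda)^-1 * V w|)
    + (c + 3 / 2 * A) * (E (fun w => `|r (W w)|) * lambda^-1)
    + (1 + c) / 4 * (A ^+ 3 * lambda^-1) + 3 / 2 * A
    + (2 * lambda)^-1 * E (fun w => large_jump A (W w) (W' w)) by field.
have h : (1 + c) / 4 * (A ^+ 3 * lambda^-1) <= 41 / 100 * A ^+ 3 / lambda.
  by rewrite -[leRHS]mulrA ler_wpM2r// mulr_ge0 ?exprn_ge0.
by rewrite !lerD2r lerD2l.
Qed.

(** Both parts of the theorem follow: for the first the strict inequality in
    [large_jump] is weakened, for the second [large_jump] vanishes almost
    everywhere. *)
Lemma kolmogorov_bound {d' : measure_display} {T' : measurableType d'}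
    {Q : probability T' R} (Z : {RV Q >-> R}) A :
    (forall z, cdf Z z = (Phi z)%:E) -> 0 <= A ->
  (kolmogorov_distance W Z <=
     sqrte 'E_P[(fun w => (1 - (2 * lambda)^-1 * V w) ^+ 2)%R]
     + (Num.sqrt (2 * pi) / 4 + 3 / 2 * A)%:E
         * (sqrte 'E_P[(fun w => r (W w) ^+ 2)%R] * (lambda^-1)%:E)
     + (41 / 100 * A ^+ 3 / lambda)%:E
     + (3 / 2 * A)%:E
     + ((2 * lambda)^-1)%:E
         * 'E_P[(fun w => large_jump A (W w) (W' w))%R])%E.
Proof.
move=> cdfZ A0; apply: ge_ereal_sup => _ [z _ <-].
rewrite cdfZ cdf_mean -EFinB abse_EFin.
apply: (le_trans (_ : (_ <= (_ + _ + _ + _ + _)%:E)%E)).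
  by rewrite lee_fin; exact: stein_bound A0.
rewrite !EFinD -(mean_expectation (L1_large_jump A)).
rewrite -EFinM leeD2r// leeD2r// leeD2r//.
apply: leeD.
  apply: mean_norm_le_sqrt; apply: L1B; [exact: L1_cst|exact: L1Z].
rewrite EFinM lee_wpmul2l ?lee_fin ?addr_ge0 ?mulr_ge0 ?divr_ge0 ?sqrtr_ge0//.
rewrite EFinM lee_wpmul2r ?lee_fin ?invr_ge0 ?(ltW lambda0)//.
exact: mean_norm_le_sqrt irW.
Qed.

End exchangeable_pair.

Unset Implicit Arguments.

Theorem theorem2p5 (R : realType)
  (d : measure_display) (T : measurableType d) (P : probability T R)
  (W W' : {RV P >-> R})
  (hexch : exchangeable P W W')
  (lambda : R) (hlambda0 : 0 < lambda) (hlambda1 : lambda < 1)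
  (r : R -> R) (hr : measurable_fun [set: R] r)
  (hreg : {ae P, forall w, 'E_P[W' | W] w = (1 - lambda) * W w + r (W w)})
  (hW2 : ('E_P[(fun w => W w ^+ 2)%R] <= 1)%E)
  (d' : measure_display) (T' : measurableType d') (Q : probability T' R)
  (Z : {RV Q >-> R})
  (hZ : forall B : set R, measurable B ->
     distribution Q Z B = normal_prob (0 : R) 1 B) :
  (forall A : R, 0 < A ->
    (kolmogorov_distance W Z <=
       sqrte 'E_P[(fun w => (1 - (2 * lambda)^-1 *
                   'E_P[fun u => (W' u - W u) ^+ 2 | W] w) ^+ 2)%R]
       + (Num.sqrt (2 * pi) / 4 + 3 / 2 * A)%:E
           * (sqrte 'E_P[(fun w => r (W w) ^+ 2)%R] * (lambda^-1)%:E)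
       + (41 / 100 * A ^+ 3 / lambda)%:E
       + (3 / 2 * A)%:E
       + ((2 * lambda)^-1)%:E
           * 'E_P[(fun w => (W w - W' w) ^+ 2 *
                    \1_[set u | A <= `|W u - W' u|] w)%R])%E)
  /\
  (forall A : R, {ae P, forall w, `|W w - W' w| <= A} ->
    (kolmogorov_distance W Z <=
       sqrte 'E_P[(fun w => (1 - (2 * lambda)^-1 *
                   'E_P[fun u => (W' u - W u) ^+ 2 | W] w) ^+ 2)%R]
       + (Num.sqrt (2 * pi) / 4 + 3 / 2 * A)%:E
           * (sqrte 'E_P[(fun w => r (W w) ^+ 2)%R] * (lambda^-1)%:E)
       + (41 / 100 * A ^+ 3 / lambda)%:E
       + (3 / 2 * A)%:E)%E).
Proof.
have cdfZ z : cdf Z z = (Phi z)%:E.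
  rewrite /cdf hZ// /Phi fineK//.
  exact: (fin_num_measure (normal_prob 0 1 : probability _ R)).
have bound A (A0 : 0 <= A) :=
  kolmogorov_bound hexch hlambda0 hr hreg hW2 cdfZ A0.
have mD A : measurable_fun setT (fun w => large_jump A (W w) (W' w)).
  by apply: measurable_large_jump; exact: measurable_funPT.
have jump_ge0 A w : 0 <= large_jump A (W w) (W' w).
  by rewrite mulr_ge0 ?sqr_ge0 ?ler0n.
have mW : measurable_fun setT W by exact: measurable_funPT.
have mW' : measurable_fun setT W' by exact: measurable_funPT.
split=> [A A0|A WA].
- apply: (le_trans (bound _ (ltW A0))); rewrite leeD2l//.
  rewrite lee_wpmul2l ?lee_fin ?invr_ge0 ?mulr_ge0 ?(ltW hlambda0)//.
  have -> : (fun w => (W w - W' w) ^+ 2 * \1_[set u | A <= `|W u - W' u|] w) =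
            (fun w => (W' w - W w) ^+ 2 * (A <= `|W' w - W w|)%R%:R).
    apply/funext => w; rewrite -sqrrN opprB indicE (distrC (W' w)).
    congr (_ * (nat_of_bool _)%:R); apply/idP/idP; first by rewrite inE.
    by move=> h; rewrite inE.
  rewrite unlock; apply: ge0_le_integral => //.
  + by move=> w _; rewrite lee_fin.
  + exact/measurable_EFinP.
  + apply/measurable_EFinP; apply: measurable_funM.
      by apply: measurable_funX; exact: measurable_funB.
    apply: measurable_fun_bool_natr; apply: measurable_fun_ler => //.
    by apply: measurableT_comp => //; exact: measurable_funB.
  + move=> w _; rewrite lee_fin ler_wpM2l ?sqr_ge0// ler_nat.
    by case: (ltgtP A).
- have A0 : 0 <= A.
    have [w] : exists w, `|W w - W' w| <= A.
      apply/not_existsP => WAn; have := WA => -[N [mN PN0 subN]].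
      have : P setT = 0%E.
        apply: subset_measure0 PN0 => //; apply: subset_trans subN => w _.
        exact: WAn.
      by rewrite probability_setT => /eqP; rewrite eqe oner_eq0.
    exact: le_trans.
  have jump0 : ('E_P[(fun w => large_jump A (W w) (W' w))%R] = 0)%E.
    rewrite unlock (ae_eq_integral (cst 0%E)) ?integral0//.
      exact/measurable_EFinP.
    apply: filterS WA => w /= WAw _.
    by rewrite /large_jump distrC ltNge WAw mulr0.
  by have := bound _ A0; rewrite jump0 mule0 adde0.
Qed.
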